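(* Let $A$ be a post-Lie algebra, $U(A)$ its universal enveloping algebra (a D-algebra), and $\iota\colon A\hookrightarrow\operatorname{Der}(U(A))$ the inclusion. For any D-algebra $B$ and any post-Lie morphism $f\colon A\to\operatorname{Der}(B)$ there exists a unique D-algebra morphism $\mathcal{F}\colon U(A)\to B$ such that $\operatorname{Der}(\mathcal{F})\circ\iota=f$, i.e. $\mathcal{F}(\iota(a))=f(a)$ for all $a\in A$.
   Context: All algebras are vector spaces over a field $\mathrm{k}$ of characteristic $0$ and all products are bilinear. Post-Lie algebra: a Lie algebra $\{A,[\cdot,\cdot]\}$ together with a bilinear product $\triangleright\colon A\times A\to A$ such that for all $x,y,z\in A$: $x\triangleright[y,z]=[x\triangleright y,z]+[y,x\triangleright z]$ and $[x,y]\triangleright z=a_\triangleright(x,y,z)-a_\triangleright(y,x,z)$, where $a_\triangleright(x,y,z):=x\triangleright(y\triangleright z)-(x\triangleright y)\triangleright z$. A post-Lie morphism is a linear map preserving $[\cdot,\cdot]$ and $\triangleright$. D-algebra: let $B$ be a unital associative algebra with product $u,v\mapsto uv$ and unit $\mathbb{1}$, equipped with a non-associative product $\triangleright\colon B\otimes B\to B$ such that $\mathbb{1}\triangleright v=v$ for all $v\in B$. Put $$\operatorname{Der}(B)=\{u\in B \mid u\triangleright(vw)=(u\triangleright v)w+v(u\triangleright w)\ \text{for all } v,w\in B\}.$$ $B$ is a D-algebra if the associative product generates $B$ from $\{\mathbb{1},\operatorname{Der}(B)\}$ and, for any $u\in\operatorname{Der}(B)$ and any $v,w\in B$, one has $v\triangleright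 u\in\operatorname{Der}(B)$ and $(uv)\triangleright w=u\triangleright(v\triangleright w)-(u\triangleright v)\triangleright w$. For a D-algebra $B$, $\operatorname{Der}(B)$ is a post-Lie algebra with bracket $[u,v]=uv-vu$ and product $\triangleright$. D-algebra morphism: a linear map $\mathcal{F}\colon B'\to B$ between D-algebras with $\mathcal{F}(\mathbb{1})=\mathbb{1}$, $\mathcal{F}(uv)=\mathcal{F}(u)\mathcal{F}(v)$, $\mathcal{F}(u\triangleright v)=\mathcal{F}(u)\triangleright\mathcal{F}(v)$. $\operatorname{Der}(\mathcal{F})$ denotes the restriction of $\mathcal{F}$ to derivations. Universal enveloping algebra of a post-Lie algebra $A$: the universal enveloping algebra $U(A)$ of the Lie algebra $\{A,[\cdot,\cdot]\}$ (with $A\subset U(A)$ and $[u,v]=uv-vu$), equipped with the unique extension of $\triangleright$ from $A$ to $U(A)$ satisfying, for all $u\in A$, $v,w\in U(A)$: $\mathbb{1}\triangleright v=v$, $u\triangleright(vw)=(u\triangleright v)w+v(u\triangleright w)$, and $(uv)\triangleright w=u\triangleright(v\triangleright w)-(u\triangleright v)\triangleright w$. It is a D-algebra with $A\subset\operatorname{Der}(U(A))$. *)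

(* Defs.v *)
From HB Require Import structures.
From mathcomp Require Import all_boot all_order all_algebra.
From mathcomp Require Import boolp.

Set Implicit Arguments.
Unset Strict Implicit.
Unset Printing Implicit Defensive.

Import GRing.Theory.
Local Open Scope ring_scope.

HB.mixin Record Lmodule_isPostLie (k : fieldType) A of GRing.Lmodule k A := {
  lieb : A -> A -> A;
  plact : A -> A -> A;
  lieb_linearl : forall y : A, linear (fun x => lieb x y);
  lieb_linearr : forall x : A, linear (fun y => lieb x y);
  liebxx : forall x : A, lieb x x = 0;
  lieb_jacobi : forall x y z : A,
    lieb x (lieb y z) + lieb y (lieb z x) + lieb z (lieb x y) = 0;
  plact_linearl : forall y : A, linear (fun x => plact x y);
  plact_linearr : forall x : A, linear (fun y => plact x y);
  plact_lieb : forall x y z : A,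
    plact x (lieb y z) = lieb (plact x y) z + lieb y (plact x z);
  lieb_plact : forall x y z : A,
    plact (lieb x y) z =
      (plact x (plact y z) - plact (plact x y) z)
      - (plact y (plact x z) - plact (plact y x) z)
}.

#[short(type="postLieType")]
HB.structure Definition PostLie (k : fieldType) :=
  {A of GRing.Lmodule k A & Lmodule_isPostLie k A}.

Definition postlie_morphism (k : fieldType) (A A' : postLieType k)
    (f : A -> A') : Prop :=
  [/\ linear f,
      forall x y : A, f (lieb x y) = lieb (f x) (f y)
    & forall x y : A, f (plact x y) = plact (f x) (f y)].

(* The data underlying a D-algebra. *)
HB.mixin Record Algebra_hasTri (k : fieldType) B of GRing.Algebra k B := {
  tri : B -> B -> B;
  tri_linearl : forall v : B, linear (fun u => tri u v);
  tri_linearr : forall u : B, linear (fun v => tri u v);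
  tri1 : forall v : B, tri 1 v = v
}.

#[short(type="triAlgType")]
HB.structure Definition TriAlg (k : fieldType) :=
  {B of GRing.Algebra k B & Algebra_hasTri k B}.

Definition is_der (k : fieldType) (B : triAlgType k) (u : B) : Prop :=
  forall v w : B, tri u (v * w) = tri u v * w + v * tri u w.

Definition generated_by (k : fieldType) (B : algType k)
    (X : B -> Prop) : Prop :=
  forall P : B -> Prop,
    P 1 -> (forall u, X u -> P u) ->
    (forall (c : k) u v, P u -> P v -> P (c *: u + v)) ->
    (forall u v, P u -> P v -> P (u * v)) ->
    forall u, P u.

HB.mixin Record TriAlg_isDAlg (k : fieldType) B of TriAlg k B := {
  der_generate : @generated_by k B (@is_der k B);
  tri_der : forall u v : B, @is_der k B u -> @is_der k B (tri v u);
  tri_mulDer : forall u v w : B, @is_der k B u ->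
    tri (u * v) w = tri u (tri v w) - tri (tri u v) w
}.

#[short(type="dAlgType")]
HB.structure Definition DAlg (k : fieldType) :=
  {B of TriAlg k B & TriAlg_isDAlg k B}.

Definition alg_morphism (k : fieldType) (B' B : algType k)
    (F : B' -> B) : Prop :=
  [/\ linear F, F 1 = 1 & forall u v : B', F (u * v) = F u * F v].

(* It involves only the products, hence makes sense for any [triAlgType]. *)
Definition dalg_morphism (k : fieldType) (B' B : triAlgType k)
    (F : B' -> B) : Prop :=
  alg_morphism F /\ forall u v : B', F (tri u v) = tri (F u) (F v).

Section Der.
Variables (k : fieldType) (B : triAlgType k).

Definition der_pred : {pred B} := fun u => `[< is_der u >].

Lemma der_predP (u : B) : reflect (is_der u) (u \in der_pred).
Proof. exact: asboolP. Qed.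

Lemma tri0 (v : B) : tri 0 v = 0.
Proof.
have := tri_linearl v (-1) 0 0.
by rewrite scaler0 addr0 scaleN1r addNr.
Qed.

Lemma tri_addl (u v w : B) : tri (u + v) w = tri u w + tri v w.
Proof. by have := tri_linearl w 1 u v; rewrite !scale1r. Qed.

Lemma tri_addr (u v w : B) : tri u (v + w) = tri u v + tri u w.
Proof. by have := tri_linearr u 1 v w; rewrite !scale1r. Qed.

Lemma tri_scalel c (u w : B) : tri (c *: u) w = c *: tri u w.
Proof. by have := tri_linearl w c u 0; rewrite addr0 tri0 addr0. Qed.

Lemma tri_oppl (u w : B) : tri (- u) w = - tri u w.
Proof. by rewrite -scaleN1r tri_scalel scaleN1r. Qed.

Lemma tri_oppr (u w : B) : tri u (- w) = - tri u w.
Proof.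
by apply/eqP; rewrite -subr_eq0 opprK -tri_addr addNr; apply/eqP;
  have := tri_linearr u (-1) 0 0; rewrite scaler0 addr0 scaleN1r addNr.
Qed.

Lemma der_submod_closed : subsemimod_closed der_pred.
Proof.
split; first split.
- by apply/der_predP => v w; rewrite !tri0 mul0r mulr0 addr0.
- move=> u v /der_predP du /der_predP dv; apply/der_predP => x y.
  by rewrite !tri_addl du dv mulrDl mulrDr addrACA.
- move=> c u /der_predP du; apply/der_predP => x y.
  by rewrite !tri_scalel du scalerDr -scalerAl -scalerAr.
Qed.

Record Der := MkDer { der_val :> B; _ : der_val \in der_pred }.

HB.instance Definition _ := [isSub for der_val].
HB.instance Definition _ := [Choice of Der by <:].
HB.instance Definition _ :=
  GRing.SubChoice_isSubLmodule.Build k B der_pred Der der_submod_closed.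

Lemma DerP (u : Der) : is_der (u : B).
Proof. exact/der_predP/(valP u). Qed.

End Der.

Section DerPostLie.
Variables (k : fieldType) (B : dAlgType k).

Lemma tri_comm (u v w : B) : is_der u -> is_der v ->
  tri (u * v - v * u) w =
    (tri u (tri v w) - tri (tri u v) w) - (tri v (tri u w) - tri (tri v u) w).
Proof. by move=> du dv; rewrite tri_addl tri_oppl !tri_mulDer. Qed.

Lemma is_der_comm (u v : Der B) :
  is_der (der_val u * der_val v - der_val v * der_val u).
Proof.
have [du dv] := (DerP u, DerP v).
have duv := tri_der (der_val v) (der_val u) dv.
have dvu := tri_der (der_val u) (der_val v) du.
move=> x y; rewrite !tri_comm // duv dvu.
rewrite dv (du x y) !tri_addr !du !dv.
have subDD (a b c d : B) : a + b - (c + d) = (a - c) + (b - d).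
  by rewrite opprD addrACA.
have mid (a b c d : B) : (a + b) + (c + d) = (a + d) + (c + b).
  by rewrite addrACA (addrC b) addrACA addrC -addrA addrCA addrA.
rewrite !mulrBl !mulrBr.
set b1 := tri u x * tri v y; set b2 := tri v x * tri u y.
set a1 := tri u (tri v x) * y; set a2 := x * tri u (tri v y).
set a3 := tri v (tri u x) * y; set a4 := x * tri v (tri u y).
rewrite (mid a1) (mid a3) [b2 + b1]addrC.
rewrite -[X in X - _]addrA -[X in _ - X]addrA ![(b1 + b2) + _ in LHS]addrC.
rewrite ![in LHS]addrA subDD subrr addr0 subDD subrr addr0.
by rewrite (subDD a1 a2) (subDD a3 a4) subDD.
Qed.

Definition der_bracket (u v : Der B) : Der B :=
  MkDer (introT (der_predP _) (is_der_comm u v)).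

Definition der_tri (u v : Der B) : Der B :=
  MkDer (introT (der_predP _) (tri_der (der_val v) (der_val u) (DerP v))).

Fact der_bracket_linearl (v : Der B) : linear (fun u => der_bracket u v).
Proof.
move=> c u u'; apply: val_inj; rewrite /= mulrDl mulrDr opprD addrACA.
by rewrite -scalerAl -scalerAr -scalerBr.
Qed.

Fact der_bracket_linearr (u : Der B) : linear (fun v => der_bracket u v).
Proof.
move=> c v v'; apply: val_inj; rewrite /= mulrDl mulrDr opprD addrACA.
by rewrite -scalerAl -scalerAr -scalerBr.
Qed.

Fact der_bracketxx (u : Der B) : der_bracket u u = 0.
Proof. by apply: val_inj; rewrite /= subrr. Qed.

Fact der_bracket_jacobi (x y z : Der B) :
  der_bracket x (der_bracket y z) + der_bracket y (der_bracket z x)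
    + der_bracket z (der_bracket x y) = 0.
Proof.
apply: val_inj => /=.
move: (der_val x) (der_val y) (der_val z) => a b c.
rewrite !mulrBl !mulrBr !opprB !mulrA.
set p1 := a * b * c; set p2 := a * c * b; set p3 := b * c * a.
set p4 := c * b * a; set p5 := b * a * c; set p6 := c * a * b.
have subDD (a' b' c' d' : B) : a' - b' + (c' - d') = (a' + c') - (b' + d').
  by rewrite opprD addrACA.
rewrite (subDD p1) (subDD p3) (subDD p6).
rewrite [p3 + p2]addrC [p6 + p5]addrC [p4 + p1]addrC.
have tele (a' b' c' : B) : a' - b' + (b' - c') + (c' - a') = 0.
  by rewrite !addrA !subrK subrr.
exact: tele.
Qed.

Fact der_tri_linearl (v : Der B) : linear (fun u => der_tri u v).
Proof. by move=> c u u'; apply: val_inj; rewrite /= tri_linearl. Qed.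

Fact der_tri_linearr (u : Der B) : linear (fun v => der_tri u v).
Proof. by move=> c v v'; apply: val_inj; rewrite /= tri_linearr. Qed.

Fact der_tri_bracket (x y z : Der B) :
  der_tri x (der_bracket y z) =
    der_bracket (der_tri x y) z + der_bracket y (der_tri x z).
Proof.
apply: val_inj => /=; have dx := DerP x.
by rewrite tri_addr tri_oppr !dx opprD addrACA [X in _ + X]addrC addrACA
  [X in _ + X]addrC.
Qed.

Fact der_bracket_tri (x y z : Der B) :
  der_tri (der_bracket x y) z =
    (der_tri x (der_tri y z) - der_tri (der_tri x y) z)
    - (der_tri y (der_tri x z) - der_tri (der_tri y x) z).
Proof. by apply: val_inj; rewrite /= tri_comm //; exact: DerP. Qed.

HB.instance Definition _ := Lmodule_isPostLie.Build k (Der B)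
  der_bracket_linearl der_bracket_linearr der_bracketxx der_bracket_jacobi
  der_tri_linearl der_tri_linearr der_tri_bracket der_bracket_tri.

End DerPostLie.

Definition lie_morphism_to_alg (k : fieldType) (A : postLieType k)
    (C : algType k) (g : A -> C) : Prop :=
  linear g /\ forall x y : A, g (lieb x y) = g x * g y - g y * g x.

Definition lie_enveloping (k : fieldType) (A : postLieType k)
    (U : algType k) (iota : A -> U) : Prop :=
  lie_morphism_to_alg iota /\
  forall (C : algType k) (g : A -> C), lie_morphism_to_alg g ->
    exists! G : U -> C, alg_morphism G /\ forall a, G (iota a) = g a.

(* [U] with [iota] is the universal enveloping algebra of the post-Lie algebra
   [A]. Injectivity of [iota] follows from Poincare-Birkhoff-Witt. *)
Record postlie_enveloping (k : fieldType) (A : postLieType k)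
    (U : triAlgType k) (iota : A -> U) : Prop := {
  enveloping_lie : lie_enveloping iota;
  tri_iota : forall a b : A, tri (iota a) (iota b) = iota (plact a b);
  iota_der : forall a : A, is_der (iota a);
  tri_mul_iota : forall (a : A) (v w : U),
    tri (iota a * v) w =
      tri (iota a) (tri v w) - tri (tri (iota a) v) w
}.

(* Main.v *)
(** The universal property of [U] as an associative algebra provides [F] and its
    uniqueness; it remains to see that [F] preserves the product [tri]. As [iota A]
    generates [U], this holds for [tri (iota a) v], where both sides are derivations
    in [v]. For [tri u v] one goes from [u] to [iota b * u] by the rule
    [(b u) > v = b > (u > v) - (b > u) > v]; since it involves [b > u], the induction
    hypothesis has to range over all images of [u] under iterated operators
    [iota a > _]. *)
Require Import Defs.
From HB Require Import structures.
From mathcomp Require Import all_boot all_order all_algebra.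
From mathcomp Require Import boolp.

Set Implicit Arguments.
Unset Strict Implicit.
Unset Printing Implicit Defensive.

Import GRing.Theory.
Local Open Scope ring_scope.

Section GeneratedSubalgebra.
Variables (k : fieldType) (U : algType k) (X : U -> Prop).

(** The condition [generated_by] imposes on every element, imposed on [u] alone: [X] generates [U]
    exactly when all of [U] satisfies it. *)
Definition gen_pred : {pred U} := fun u => `[<
  forall P : U -> Prop,
    P 1 -> (forall u, X u -> P u) ->
    (forall (c : k) u v, P u -> P v -> P (c *: u + v)) ->
    (forall u v, P u -> P v -> P (u * v)) -> P u >].

Lemma gen_predX u : X u -> u \in gen_pred.
Proof. by move=> Xu; apply/asboolP => P _ PX _ _; apply: PX. Qed.

Lemma gen_pred_subalg_closed : subalg_closed gen_pred.
Proof.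
split=> [|c u v /asboolP gu /asboolP gv|u v /asboolP gu /asboolP gv];
  apply/asboolP => P P1 PX PL PM //.
- exact: PL (gu P P1 PX PL PM) (gv P P1 PX PL PM).
- exact: PM (gu P P1 PX PL PM) (gv P P1 PX PL PM).
Qed.

Record genAlg := MkGenAlg { gen_val :> U; _ : gen_val \in gen_pred }.

HB.instance Definition _ := [isSub for gen_val].
HB.instance Definition _ := [Choice of genAlg by <:].
HB.instance Definition _ :=
  GRing.SubChoice_isSubAlgebra.Build k U gen_pred genAlg
    (GRing.subalg_closed_semi gen_pred_subalg_closed).

End GeneratedSubalgebra.

Section Enveloping.
Variables (k : fieldType) (A : postLieType k) (U : algType k) (iota : A -> U).
Hypothesis envU : lie_enveloping iota.

(* Corestrict [iota] to the subalgebra it generates; the induced endomorphism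
   of [U] has values in that subalgebra and, by uniqueness, is the identity. *)
Lemma enveloping_generated : generated_by (fun u : U => exists a, u = iota a).
Proof.
set X := fun u : U => _.
have [[iotaL iotaB] univ] := envU.
have iX a : iota a \in gen_pred X by apply: gen_predX; exists a.
pose g a : genAlg X := MkGenAlg (iX a).
have g_lie : lie_morphism_to_alg g.
  split=> [c a b|a b]; apply: val_inj; first exact: iotaL.
  by rewrite /= iotaB.
have [G [[[GL G1 GM] Gi] _]] := univ (genAlg X) g g_lie.
have [H [_ Huniq]] := univ U iota (conj iotaL iotaB).
have HG : H = fun u => val (G u).
  apply: Huniq; split=> [|a]; last by rewrite Gi.
  by split=> [c u v||u v]; rewrite ?GL ?G1 ?GM.
have Hid : H = id by apply: Huniq; split.
move=> P P1 PX PL PM u.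
have /asboolP gu : u \in gen_pred X.
  have <- : val (G u) = u by rewrite -[u in RHS]/(id u) -Hid HG.
  exact: (valP (G u)).
exact: gu.
Qed.

End Enveloping.

Lemma is_der1 (k : fieldType) (B : triAlgType k) (u : B) :
  is_der u -> tri u 1 = 0.
Proof.
move=> du; have := du 1 1; rewrite !mulr1 mul1r => /eqP.
by rewrite -subr_eq0 opprD addrA subrr sub0r oppr_eq0 => /eqP.
Qed.

Section Extension.
Variables (k : fieldType) (A : postLieType k) (U : triAlgType k) (iota : A -> U).
Hypothesis envU : postlie_enveloping iota.
Variables (B : dAlgType k) (f : A -> Der B) (F : U -> B).
Hypothesis f_morph : postlie_morphism f.
Hypothesis F_alg : alg_morphism F.
Hypothesis F_iota : forall a, F (iota a) = der_val (f a).

Let F0 : F 0 = 0.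
Proof.
by have [FL _ _] := F_alg; have := FL (-1) 0 0; rewrite !scaleN1r !addNr.
Qed.

Let FD u v : F (u + v) = F u + F v.
Proof. by have [FL _ _] := F_alg; have := FL 1 u v; rewrite !scale1r. Qed.

Let FB u v : F (u - v) = F u - F v.
Proof.
by have [FL _ _] := F_alg; have := FL (-1) v u; rewrite !scaleN1r ![- _ + _]addrC.
Qed.

Let FM u v : F (u * v) = F u * F v.
Proof. by have [_ _] := F_alg. Qed.

Lemma ext_tri_iota a v : F (tri (iota a) v) = tri (F (iota a)) (F v).
Proof.
have [FL F1 _] := F_alg.
have dF : is_der (F (iota a)) by rewrite F_iota; exact: DerP.
elim/(enveloping_generated (enveloping_lie envU)): v
    => [|_ [b ->]|c u v IHu IHv|u v IHu IHv].
- by rewrite F1 !is_der1 ?F0 //; exact: (iota_der envU).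
(* On generators the claim is that [f] preserves [plact]. *)
- by have [_ _ fT] := f_morph; rewrite (tri_iota envU) !F_iota fT.
- by rewrite tri_linearr !FL IHu IHv tri_linearr.
- by rewrite (iota_der envU) FD !FM IHu IHv dF.
Qed.

Definition tri_compatible u := forall v, F (tri u v) = tri (F u) (F v).

Lemma tri_compatible_linear c u v :
  tri_compatible u -> tri_compatible v -> tri_compatible (c *: u + v).
Proof.
have [FL _ _] := F_alg.
by move=> cu cv w; rewrite tri_linearl !FL cu cv tri_linearl.
Qed.

(** The rule for [tri] of a product applies on both sides, since [F (iota b)] is a derivation of
    [B]; its term [tri (tri (iota b) u) v] calls for the second hypothesis. *)
Lemma tri_compatible_mul_iota b u :
  tri_compatible u -> tri_compatible (tri (iota b) u) ->
  tri_compatible (iota b * u).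
Proof.
move=> cu cbu v; have db : is_der (F (iota b)) by rewrite F_iota; exact: DerP.
by rewrite (tri_mul_iota envU) FB FM tri_mulDer // cbu !ext_tri_iota cu.
Qed.

(** With [foldl] the head of [s] acts first, so [stable u] at [a :: t] is literally the condition on
    [tri (iota a) u] at [t]. *)
Let D (s : seq A) (u : U) : U := foldl (fun v a => tri (iota a) v) u s.

Let D_linear s c u v : D s (c *: u + v) = c *: D s u + D s v.
Proof. by elim: s u v => //= a s IHs u v; rewrite tri_linearr IHs. Qed.

Let D0 s : D s 0 = 0.
Proof. by have := D_linear s (-1) 0 0; rewrite !scaleN1r !addNr. Qed.

Let stable u := forall s, tri_compatible (D s u).

Let stable1 : stable 1.
Proof.
have [_ F1 _] := F_alg.
(* A nonempty word kills [1], as its first letter acts by a derivation. *)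
case=> [|a s] v /=; first by rewrite F1 !tri1.
by rewrite is_der1 ?D0; [rewrite F0 !tri0 F0 | exact: (iota_der envU)].
Qed.

Let stable_linear c u v : stable u -> stable v -> stable (c *: u + v).
Proof.
by move=> su sv s; rewrite D_linear; apply: tri_compatible_linear.
Qed.

Let stable_mul_iota b u : stable u -> stable (iota b * u).
Proof.
(* [b] and [u] stay general: by Leibniz the letter [a] yields [iota (plact a b) * u] and
   [iota b * tri (iota a) u], both again of the given shape. *)
move=> su s; elim: s b u su => [|a s IHs] b u su.
  exact: tri_compatible_mul_iota (su [::]) (su [:: b]).
rewrite /= (iota_der envU) (tri_iota envU) -[X in X + _]scale1r D_linear.
apply: tri_compatible_linear; apply: IHs => // t; exact: su (a :: t).
Qed.

Lemma ext_dalg_morphism : dalg_morphism F.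
Proof.
split=> // u; suff su : stable u by exact: su [::].
(* Generalising [1] to any stable [w] turns the goal into: left multiplication by [u] preserves
   [stable]. This property passes to products of such [u] by composition. *)
rewrite -[u]mulr1; move: (1 : U) stable1.
elim/(enveloping_generated (enveloping_lie envU)): u
    => [|_ [b ->]|c u v IHu IHv|u v IHu IHv] w sw.
- by rewrite mul1r.
- exact: stable_mul_iota.
- by rewrite mulrDl -scalerAl; exact: stable_linear (IHu w sw) (IHv w sw).
- by rewrite -mulrA; exact: IHu (IHv w sw).
Qed.

End Extension.

Theorem proposition3p9 (k : fieldType) (char0 : [pchar k] =i pred0)
    (A : postLieType k)
    (U : triAlgType k) (iota : A -> U) (envU : postlie_enveloping iota)
    (B : dAlgType k)
    (f : A -> Der B) (f_morph : postlie_morphism f) :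
  exists! F : U -> B,
    dalg_morphism F /\ forall a : A, F (iota a) = der_val (f a).
Proof.
have [fL fB _] := f_morph.
(* The bracket of [Der B] is the commutator of [B]. *)
have f_lie : lie_morphism_to_alg (fun a => der_val (f a)).
  by split=> [c a b|a b]; rewrite ?fL ?fB.
have [_ univ] := enveloping_lie envU.
have [F [[F_alg F_iota] Funiq]] := univ B _ f_lie.
exists F; split; first by split=> //; exact: (ext_dalg_morphism envU f_morph).
by move=> G [[G_alg _] G_iota]; apply: Funiq.
Qed.
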